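(* Let $E,J,R\in\mathbb{C}^{n,n}$ and $B\in\mathbb{C}^{n,m}$ with $E=E^H\ge 0$, $R=R^H\ge 0$, $J=-J^H$ and $B$ of full column rank (the coefficients of a port-Hamiltonian descriptor system $E\dot x=(J-R)x+Bu$, $y=B^Hx$). There exists a matrix $K\in\mathbb{C}^{m,m}$ such that the pair $(E+BKB^H,\;J-R)$ is regular and $E+BKB^H\ge 0$ if and only if $$\operatorname{rank}\begin{bmatrix}E & J-R & B\end{bmatrix}=n.$$
   Context: $\mathbb{C}^{p,q}$ denotes the complex $p\times q$ matrices. $M\ge 0$ ($M>0$) means that $M$ is Hermitian positive semidefinite (positive definite). A pair $(E,A)$ of square matrices (identified with the pencil $\lambda E-A$) is regular if $\det(\lambda_0E-A)\ne 0$ for some $\lambda_0\in\mathbb{C}$. *)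

(* Defs.v *)
From mathcomp Require Export all_boot all_order all_algebra.
From mathcomp Require Export spectral sesquilinear reals complex.

Set Implicit Arguments.
Unset Strict Implicit.
Unset Printing Implicit Defensive.

Import Order.TTheory GRing.Theory Num.Theory Num.Def.
Local Open Scope ring_scope.
Local Open Scope sesquilinear_scope.

(* F[i] is the field of complex numbers; in its partial order, [0 <= z] means that z is real and
   nonnegative. *)
Definition psd (F : realType) (n : nat) (M : 'M[F[i]]_n) : Prop :=
  M \is hermsymmx /\ forall x : 'cV[F[i]]_n, 0 <= (x ^t* *m M *m x) 0 0.

Definition regular_pair (F : realType) (n : nat) (E A : 'M[F[i]]_n) : Prop :=
  exists lambda0 : F[i], \det (lambda0 *: E - A) != 0.

(* Main.v *)
(* K = 1 works, with lambda0 = 1: if v (E + B B^* + R - J) = 0 then, as v J v^* is purely imaginary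
   and the other three forms are nonnegative, v E v^* = v R v^* = |v B|^2 = 0; hence
   v E = v R = v B = 0, so v J = 0 too, and the rank condition gives v = 0. *)
Require Import Defs.
From mathcomp Require Import ring.

Set Implicit Arguments.
Unset Strict Implicit.
Unset Printing Implicit Defensive.

Import Order.TTheory GRing.Theory Num.Theory.

Local Open Scope ring_scope.
Local Open Scope sesquilinear_scope.

Lemma trmxC_mul (C : numClosedFieldType) (m n p : nat)
    (A : 'M[C]_(m, n)) (B : 'M[C]_(n, p)) :
  (A *m B) ^t* = B ^t* *m A ^t*.
Proof. by rewrite trmx_mul map_mxM. Qed.

(** The conjugate transpose of a 1 x 1 matrix just conjugates its entry. With J^H = -J this makes
    the form of J purely imaginary. *)
Lemma trmxC_form (C : numClosedFieldType) (n : nat) (v : 'rV[C]_n) (M : 'M[C]_n) :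
  (v *m M ^t* *m v ^t*) 0 0 = ((v *m M *m v ^t*) 0 0)^*.
Proof.
have -> : v *m M ^t* *m v ^t* = (v *m M *m v ^t*) ^t*.
  by rewrite !trmxC_mul trmxCK mulmxA.
by rewrite !mxE.
Qed.

Lemma row_gramE (C : numClosedFieldType) (n : nat) (v : 'rV[C]_n) :
  (v *m v ^t*) 0 0 = \sum_j `|v 0 j| ^+ 2.
Proof. by rewrite mxE; apply: eq_bigr => j _; rewrite !mxE normCK. Qed.

Lemma row_gram_ge0 (C : numClosedFieldType) (n : nat) (v : 'rV[C]_n) :
  0 <= (v *m v ^t*) 0 0.
Proof. by rewrite row_gramE sumr_ge0 // => j _; rewrite exprn_ge0. Qed.

Lemma row_gram_eq0 (C : numClosedFieldType) (n : nat) (v : 'rV[C]_n) :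
  (v *m v ^t*) 0 0 = 0 -> v = 0.
Proof.
rewrite row_gramE => /eqP; rewrite psumr_eq0 => [/allP v0|j _]; last exact: exprn_ge0.
apply/rowP => j; rewrite mxE; apply/eqP.
by have := v0 j (mem_index_enum _); rewrite sqrf_eq0 normr_eq0.
Qed.

Lemma psd_trmxC (F : realType) (n : nat) (M : 'M[F[i]]_n) : psd M -> M ^t* = M.
Proof. by case=> /is_hermitianmxP; rewrite expr0 scale1r => <-. Qed.

(** Taking x = v^H passes from the columns tested by [psd] to rows, the natural setting for left
    null vectors. *)
Lemma psd_row_ge0 (F : realType) (n : nat) (M : 'M[F[i]]_n) (v : 'rV[F[i]]_n) :
  psd M -> 0 <= (v *m M *m v ^t*) 0 0.
Proof. by case=> _ /(_ (v ^t*)); rewrite trmxCK. Qed.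

Lemma psdD (F : realType) (n : nat) (M N : 'M[F[i]]_n) : psd M -> psd N -> psd (M + N).
Proof.
move=> psdM psdN; split => [|x].
  apply/is_hermitianmxP.
  by rewrite expr0 scale1r linearD map_mxD /= !psd_trmxC.
by rewrite mulmxDr mulmxDl mxE addr_ge0 //; [case: psdM | case: psdN].
Qed.

Lemma psd_gram (F : realType) (n m : nat) (B : 'M[F[i]]_(n, m)) : psd (B *m B ^t*).
Proof.
split => [|x]; first by apply/is_hermitianmxP; rewrite expr0 scale1r trmxC_mul trmxCK.
by have := row_gram_ge0 (x ^t* *m B); rewrite trmxC_mul trmxCK !mulmxA.
Qed.

(** Moving from v against the direction vM changes the form to first order by a negative multiple of
    |vM|^2. As the form starts at 0 and cannot become negative, vM = 0. *)
Lemma psd_form_eq0 (F : realType) (n : nat) (M : 'M[F[i]]_n) (v : 'rV[F[i]]_n) :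
  psd M -> (v *m M *m v ^t*) 0 0 = 0 -> v *m M = 0.
Proof.
move=> psdM vMv0; apply: row_gram_eq0.
set a : F[i] := (_ *m _) 0 0; set b : F[i] := (v *m M *m M *m (v *m M) ^t*) 0 0.
have a_ge0 : 0 <= a by exact: row_gram_ge0.
have b_ge0 : 0 <= b by exact: psd_row_ge0.
have aE : (v *m M *m M *m v ^t*) 0 0 = a by rewrite /a trmxC_mul psd_trmxC // mulmxA.
(* The form at this vector is a^2 b - 2 a^2 (b + 1) = - a^2 (b + 2). *)
have := psd_row_ge0 ((b + 1) *: v - a *: (v *m M)) psdM.
have -> : ((b + 1) *: v - a *: (v *m M)) ^t* = (b + 1) *: v ^t* - a *: (v *m M) ^t*.
  rewrite [_^T]linearB /= 2![(_ *: _)^T]linearZ /= map_mxB !map_mxZ /=.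
  by rewrite !conj_Creal ?realD ?ger0_real ?ler01.
rewrite !(mulmxBl, mulmxBr) -!scalemxAl -!scalemxAr.
set X1 := v *m M *m v ^t*; set X2 := v *m M *m M *m v ^t*.
set X3 := v *m M *m (v *m M) ^t*; set X4 := v *m M *m M *m (v *m M) ^t*.
(* The four products become opaque 1 x 1 matrices, so that [mxE] does not expand them into sums. *)
have [] : [/\ X1 0 0 = 0, X2 0 0 = a, X3 0 0 = a & X4 0 0 = b] by split.
move: X1 X2 X3 X4 => X1 X2 X3 X4 X1E X2E X3E X4E.
rewrite !mxE X1E X2E X3E X4E => form_ge0.
apply/eqP; rewrite -sqrf_eq0; apply/eqP/le_anti; rewrite exprn_ge0 // andbT.
have b2_gt0 : 0 < b + 2 by rewrite ltr_wpDl.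
rewrite -(pmulr_lle0 _ b2_gt0) -oppr_ge0.
by congr (0 <= _) : form_ge0; ring.
Qed.

Theorem theorem10 (F : realType) (n m : nat)
    (E J R : 'M[F[i]]_n) (B : 'M[F[i]]_(n, m))
    (hE : psd E) (hR : psd R) (hJ : J = - J ^t*) (hB : \rank B = m) :
  (exists K : 'M[F[i]]_m,
      regular_pair (E + B *m K *m B ^t*) (J - R)
      /\ psd (E + B *m K *m B ^t*))
  <-> \rank (row_mx E (row_mx (J - R) B)) = n.
Proof.
split=> [[K [[l det_neq0] _]]|rank_n].
  (* The rows of Z span the left kernel of the block row. They annihilate E, J - R and B, hence also
     the invertible matrix l(E + BKB^H) - (J - R), so Z = 0. *)
  apply/eqP; rewrite -[_ == n]/(row_free _) -kermx_eq0; apply/eqP.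
  set Z := kermx _.
  have := mulmx_ker (row_mx E (row_mx (J - R) B)); rewrite -/Z !mul_mx_row.
  move=> /eqP; rewrite !row_mx_eq0 => /and3P[/eqP ZE /eqP ZA /eqP ZB].
  apply: (row_free_inj (A := l *: (E + B *m K *m B ^t*) - (J - R))).
    by rewrite row_free_unit unitmxE unitfE.
  by rewrite mul0mx mulmxBr -scalemxAr mulmxDr !mulmxA ZE ZA ZB !mul0mx addr0 scaler0 subr0.
exists 1%:M; rewrite mulmx1; split; last exact: psdD (psd_gram B).
exists 1; apply/det0P => -[v v_neq0]; rewrite scale1r opprB => vA0.
have psdB := psd_gram B.
have vJE : v *m J = v *m E + v *m (B *m B ^t*) + v *m R.
  by apply/esym/eqP; rewrite -subr_eq0 -!mulmxDr -mulmxBr -addrA vA0.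
have := congr1 (fun X => (X *m v ^t*) 0 0) vJE.
rewrite /= !mulmxDl 2![(_ + _ : 'M_1) 0 0]mxE.
set e := (v *m E *m _) 0 0; set b := (_ *m (B *m _) *m _) 0 0.
set r := (v *m R *m _) 0 0; set j := (_ *m J *m _) 0 0 => jE.
have e_ge0 : 0 <= e by exact: psd_row_ge0.
have b_ge0 : 0 <= b by exact: psd_row_ge0.
have r_ge0 : 0 <= r by exact: psd_row_ge0.
have jN : j^* = - j.
  by rewrite -trmxC_form -[J ^t*]opprK -hJ mulmxN mulNmx mxE.
(* By [jE], j = e + b + r is real, so [jN] reads j = -j. *)
have j0 : j = 0.
  move: jN; rewrite conj_Creal; last by rewrite jE ger0_real ?addr_ge0.
  by move/eqP; rewrite -addr_eq0 -mulr2n mulrn_eq0 => /eqP.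
move: jE; rewrite j0 => /esym/eqP.
rewrite !paddr_eq0 ?addr_ge0 // => /andP[/andP[/eqP e0 /eqP b0] /eqP r0].
have vE : v *m E = 0 by exact: psd_form_eq0.
have vR : v *m R = 0 by exact: psd_form_eq0.
have vBB : v *m (B *m B ^t*) = 0 by exact: psd_form_eq0.
(* The squared norm of vB is (v B B^H) v^H, which vanishes by [vBB]. *)
have vB : v *m B = 0.
  by apply: row_gram_eq0; rewrite trmxC_mul mulmxA -(mulmxA v) vBB mul0mx mxE.
have vJ : v *m J = 0 by rewrite vJE vE vBB vR !addr0.
move/eqP: v_neq0; apply.
apply: (row_free_inj (A := row_mx E (row_mx (J - R) B))); first exact/eqP.
by rewrite mul0mx !mul_mx_row mulmxBr vE vJ vR vB subr0 !row_mx0.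
Qed.
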